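(* ($\mathbf{ZF}$) Every compact metrizable cuf space is scattered. In particular, every compact metrizable countable space is scattered.
   Context: The theorem is in $\mathbf{ZF}$ (no axiom of choice). A cuf space is a topological space whose underlying set is a countable union of finite sets. A topological space is scattered if every non-empty subspace has an isolated point. Compact means every open cover has a finite subcover. *)

(* Defs.v *)
(* A theorem of ZF is rendered as a statement about every model of first-order
   ZF.  Stating it about Rocq types, or about [topologicalType] (which carries a
   choice operator), would let choice in: under choice a countable union of
   finite sets is just a countable set.  All notions below are therefore those
   of the object theory: they quantify only over elements of the model, and each
   of them unfolds to a first-order formula in membership and equality.

   The ambient [nat] occurs solely as variable indices of formulas, never as the
   natural numbers of the model. *)

Record set_structure : Type := SetStructure {
  carrier :> Type;
  mem : carrier -> carrier -> Prop
}.
Arguments mem {s} _ _.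

Notation "x ∈ y" := (mem x y) (at level 70, no associativity).
Notation "x ∉ y" := (~ mem x y) (at level 70, no associativity).

(* First-order formulas of set theory, with de Bruijn indices. *)
Inductive form : Type :=
| Fmem (i j : nat)
| Feq (i j : nat)
| Fbot
| Fand (f g : form)
| For (f g : form)
| Fimp (f g : form)
| Fall (f : form)
| Fex (f : form).

Definition scons {M : Type} (x : M) (e : nat -> M) (n : nat) : M :=
  match n with
  | O => x
  | S m => e m
  end.

Fixpoint sat (M : set_structure) (e : nat -> M) (f : form) : Prop :=
  match f with
  | Fmem i j => e i ∈ e j
  | Feq i j => e i = e j
  | Fbot => False
  | Fand g h => sat M e g /\ sat M e h
  | For g h => sat M e g \/ sat M e h
  | Fimp g h => sat M e g -> sat M e h
  | Fall g => forall x : M, sat M (scons x e) g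
  | Fex g => exists x : M, sat M (scons x e) g
  end.

Section SetTheory.
Context {M : set_structure}.
Implicit Types (a b c p x y z f A B P X Y T U V W S C : M).

Definition subset A B : Prop := forall x, x ∈ A -> x ∈ B.
Definition is_empty x : Prop := forall z, z ∉ x.
Definition nonempty x : Prop := exists z, z ∈ x.
Definition is_singleton x a : Prop := forall z, z ∈ x <-> z = a.
Definition is_pair x a b : Prop := forall z, z ∈ x <-> z = a \/ z = b.
Definition is_union X A : Prop := forall z, z ∈ X <-> exists a, a ∈ A /\ z ∈ a.
Definition is_inter X A B : Prop := forall z, z ∈ X <-> z ∈ A /\ z ∈ B.
Definition is_succ y x : Prop := forall z, z ∈ y <-> z ∈ x \/ z = x.

Definition inductive_set x : Prop :=
  (exists z, is_empty z /\ z ∈ x) /\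
  (forall z, z ∈ x -> exists s, is_succ s z /\ s ∈ x).

(* Kuratowski pairs: [p = {{a}, {a, b}}]. *)
Definition is_opair p a b : Prop :=
  exists u v, is_singleton u a /\ is_pair v a b /\ is_pair p u v.

Definition is_prod P A B : Prop :=
  forall p, p ∈ P <-> exists a b, a ∈ A /\ b ∈ B /\ is_opair p a b.

Definition related f x y : Prop := exists p, is_opair p x y /\ p ∈ f.

Definition is_fun f A B : Prop :=
  (forall p, p ∈ f -> exists a b, a ∈ A /\ b ∈ B /\ is_opair p a b) /\
  (forall a, a ∈ A -> exists! b, related f a b).

Definition is_inj f A B : Prop :=
  is_fun f A B /\
  (forall a a' b, related f a b -> related f a' b -> a = a').

Definition is_bij f A B : Prop :=
  is_inj f A B /\ (forall b, b ∈ B -> exists a, related f a b).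

Definition is_omega x : Prop :=
  inductive_set x /\ (forall y, inductive_set y -> subset x y).

Definition finite_set x : Prop :=
  exists w n f, is_omega w /\ n ∈ w /\ is_bij f n x.

(* At most countable, so that finite sets are included. *)
Definition countable_set x : Prop :=
  exists w f, is_omega w /\ is_inj f x w.

Definition cuf X : Prop :=
  exists A, countable_set A /\ (forall a, a ∈ A -> finite_set a) /\ is_union X A.

(* [T] is the family of open sets of the topological space with underlying set
   [X]; open covers of [X] are taken inside [T]. *)
Definition topology X T : Prop :=
  (forall U, U ∈ T -> subset U X) /\
  (forall U, is_empty U -> U ∈ T) /\
  X ∈ T /\
  (forall U V W, U ∈ T -> V ∈ T -> is_inter W U V -> W ∈ T) /\
  (forall C U, subset C T -> is_union U C -> U ∈ T).

Definition compact X T : Prop :=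
  forall C, subset C T -> is_union X C ->
  exists C', subset C' C /\ finite_set C' /\ is_union X C'.

Definition subspace_topology TS X T S : Prop :=
  subset S X /\
  (forall V, V ∈ TS <-> exists U, U ∈ T /\ is_inter V U S).

Definition isolated_point x X T : Prop :=
  x ∈ X /\ exists U, U ∈ T /\ is_singleton U x.

Definition scattered X T : Prop :=
  forall S TS, subspace_topology TS X T S -> nonempty S ->
  exists x, isolated_point x S TS.

Definition app2 f x y z : Prop := exists p, is_opair p x y /\ related f p z.

Definition is_fun2 f A B C : Prop := exists P, is_prod P A B /\ is_fun f P C.

End SetTheory.

Record ZF (M : set_structure) : Prop := {
  ZF_extensionality :
    forall x y : M, (forall z : M, z ∈ x <-> z ∈ y) -> x = y;
  ZF_foundation :
    forall x : M, nonempty x ->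
    exists y : M, y ∈ x /\ (forall z : M, z ∈ y -> z ∉ x);
  ZF_pairing : forall a b : M, exists x : M, is_pair x a b;
  ZF_union : forall A : M, exists X : M, is_union X A;
  ZF_power : forall A : M, exists X : M, forall z : M, z ∈ X <-> subset z A;
  ZF_infinity : exists x : M, inductive_set x;
  ZF_separation :
    forall (f : form) (e : nat -> M) (A : M),
    exists X : M, forall x : M, x ∈ X <-> x ∈ A /\ sat M (scons x e) f;
  ZF_replacement :
    forall (f : form) (e : nat -> M) (A : M),
    (forall x y y' : M, x ∈ A -> sat M (scons y (scons x e)) f ->
       sat M (scons y' (scons x e)) f -> y = y') ->
    exists X : M, forall y : M,
      y ∈ X <-> exists x : M, x ∈ A /\ sat M (scons y (scons x e)) f
}.

(* The real line of the model is any Dedekind-complete ordered field of the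
   model, which ZF proves to be unique up to isomorphism.  The operations and
   the order are sets of the model, hence they are written relationally:
   [Add F x y z] reads "x + y = z". *)
Record field_data (M : set_structure) : Type := FieldData {
  R_set : M;
  R_add : M;
  R_mul : M;
  R_le : M;
  R_zero : M;
  R_one : M
}.
Arguments R_set {M} _.
Arguments R_add {M} _.
Arguments R_mul {M} _.
Arguments R_le {M} _.
Arguments R_zero {M} _.
Arguments R_one {M} _.

Section Reals.
Context {M : set_structure}.
Implicit Types (F : field_data M) (x y z s t u v b S X T U d : M).

Definition Add F x y z : Prop := app2 (R_add F) x y z.
Definition Mul F x y z : Prop := app2 (R_mul F) x y z.
Definition Le F x y : Prop := related (R_le F) x y.
Definition Lt F x y : Prop := Le F x y /\ x <> y.

Definition upper_bound F S b : Prop :=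
  b ∈ R_set F /\ (forall x, x ∈ S -> Le F x b).

Record complete_ordered_field F : Prop := {
  R_add_fun : is_fun2 (R_add F) (R_set F) (R_set F) (R_set F);
  R_mul_fun : is_fun2 (R_mul F) (R_set F) (R_set F) (R_set F);
  R_zero_mem : R_zero F ∈ R_set F;
  R_one_mem : R_one F ∈ R_set F;
  R_zero_neq_one : R_zero F <> R_one F;
  R_add_assoc : forall x y z s t u,
    Add F x y s -> Add F s z u -> Add F y z t -> Add F x t u;
  R_add_comm : forall x y z, Add F x y z -> Add F y x z;
  R_add_zero : forall x, x ∈ R_set F -> Add F x (R_zero F) x;
  R_add_opp : forall x, x ∈ R_set F ->
    exists y, y ∈ R_set F /\ Add F x y (R_zero F);
  R_mul_assoc : forall x y z s t u,
    Mul F x y s -> Mul F s z u -> Mul F y z t -> Mul F x t u;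
  R_mul_comm : forall x y z, Mul F x y z -> Mul F y x z;
  R_mul_one : forall x, x ∈ R_set F -> Mul F x (R_one F) x;
  R_mul_inv : forall x, x ∈ R_set F -> x <> R_zero F ->
    exists y, y ∈ R_set F /\ Mul F x y (R_one F);
  R_distr : forall x y z s t u v,
    Add F y z s -> Mul F x s t -> Mul F x y u -> Mul F x z v -> Add F u v t;
  R_le_total : forall x y, x ∈ R_set F -> y ∈ R_set F -> Le F x y \/ Le F y x;
  R_le_antisym : forall x y, x ∈ R_set F -> y ∈ R_set F ->
    Le F x y -> Le F y x -> x = y;
  R_le_trans : forall x y z, x ∈ R_set F -> y ∈ R_set F -> z ∈ R_set F ->
    Le F x y -> Le F y z -> Le F x z;
  R_le_add : forall x y z s t, x ∈ R_set F -> y ∈ R_set F ->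
    Le F x y -> Add F x z s -> Add F y z t -> Le F s t;
  R_le_mul : forall x y z, Le F (R_zero F) x -> Le F (R_zero F) y ->
    Mul F x y z -> Le F (R_zero F) z;
  R_complete : forall S, subset S (R_set F) -> nonempty S ->
    (exists b, upper_bound F S b) ->
    exists s, upper_bound F S s /\ (forall b, upper_bound F S b -> Le F s b)
}.

(* [app2 d x y t] reads "d(x, y) = t". *)
Record metric F X d : Prop := {
  metric_fun : is_fun2 d X X (R_set F);
  metric_nonneg : forall x y t, app2 d x y t -> Le F (R_zero F) t;
  metric_zero : forall x y, x ∈ X -> y ∈ X ->
    (app2 d x y (R_zero F) <-> x = y);
  metric_sym : forall x y t, app2 d x y t -> app2 d y x t;
  metric_triangle : forall x y z s t u v,
    app2 d x y s -> app2 d y z t -> app2 d x z u -> Add F s t v -> Le F u v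
}.

Definition in_ball F d x s y : Prop := exists t, app2 d x y t /\ Lt F t s.

Definition metric_open F X d U : Prop :=
  subset U X /\
  (forall x, x ∈ U -> exists s, s ∈ R_set F /\ Lt F (R_zero F) s /\
     (forall y, y ∈ X -> in_ball F d x s y -> y ∈ U)).

Definition metrizable X T : Prop :=
  exists (F : field_data M) d, complete_ordered_field F /\ metric F X d /\
  (forall U, U ∈ T <-> metric_open F X d U).

End Reals.

(* Main.v *)
(** Suppose a non-empty [S] in the compact metric space [X] has no isolated
    point, and let [X] be covered by finite pieces indexed by omega.  As in
    Baire's theorem one builds open sets [U 0 = X], [U 1], ..., all meeting [S],
    such that the closure of [U (n+1)] lies in [U n] and misses the [n]-th
    piece; the open sets disjoint from some [U n] then cover [X] without finite
    subcover.  No choice is involved, because [U (n+1)] can be defined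
    explicitly: it is the interior of the set of points whose [r]-ball lies in
    [U n] minus the [n]-th piece, where [r] is half the supremum of the
    (bounded) radii for which this interior meets [S]. *)

Require Import Defs.
From Stdlib Require Import Classical Arith.

(** * Definability with parameters *)

Section Definability.
Context {M : set_structure}.

Definition up (xi : nat -> nat) (n : nat) : nat :=
  match n with O => O | S m => S (xi m) end.

Fixpoint ren (xi : nat -> nat) (f : form) : form :=
  match f with
  | Fmem i j => Fmem (xi i) (xi j)
  | Feq i j => Feq (xi i) (xi j)
  | Fbot => Fbot
  | Fand g h => Fand (ren xi g) (ren xi h)
  | For g h => For (ren xi g) (ren xi h)
  | Fimp g h => Fimp (ren xi g) (ren xi h)
  | Fall g => Fall (ren (up xi) g)
  | Fex g => Fex (ren (up xi) g)
  end.

Lemma sat_ren (f : form) : forall (xi : nat -> nat) (e e' : nat -> M),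
  (forall n, e' n = e (xi n)) -> (sat M e (ren xi f) <-> sat M e' f).
Proof.
  assert (Hup : forall xi (e e' : nat -> M) x, (forall n, e' n = e (xi n)) ->
    forall n, scons x e' n = scons x e (up xi n)).
  { intros xi e e' x H [|n]; simpl; auto. }
  induction f as [i j|i j| |g IHg h IHh|g IHg h IHh|g IHg h IHh|g IHg|g IHg];
    intros xi e e' H; simpl.
  - now rewrite !H.
  - now rewrite !H.
  - tauto.
  - now rewrite (IHg xi e e' H), (IHh xi e e' H).
  - now rewrite (IHg xi e e' H), (IHh xi e e' H).
  - now rewrite (IHg xi e e' H), (IHh xi e e' H).
  - split; intros K x; apply (IHg _ _ _ (Hup xi e e' x H)); apply K.
  - split; intros [x K]; exists x; apply (IHg _ _ _ (Hup xi e e' x H)); apply K.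
Qed.

(* A slot of an environment holds either a variable or a parameter from [M]. *)
Definition slot_val (s : nat + M) (e : nat -> M) : M :=
  match s with inl i => e i | inr m => m end.

Definition definable (P : (nat -> M) -> Prop) : Prop :=
  exists f (g : nat -> nat + M), forall e,
    P e <-> sat M (fun n => slot_val (g n) e) f.

Definition is_term (t : (nat -> M) -> M) : Prop :=
  exists s : nat + M, forall e, t e = slot_val s e.

Lemma definable_merge (P Q : (nat -> M) -> Prop) :
  definable P -> definable Q ->
  exists f h (g : nat -> nat + M), forall e,
    (P e <-> sat M (fun n => slot_val (g n) e) f) /\
    (Q e <-> sat M (fun n => slot_val (g n) e) h).
Proof.
  intros (f & g & Hf) (h & k & Hh).
  exists (ren (fun n => 2 * n) f), (ren (fun n => S (2 * n)) h),
    (fun n => if Nat.even n then g (Nat.div2 n) else k (Nat.div2 n)).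
  intro e. rewrite Hf, Hh. split; symmetry; apply sat_ren; intro n.
  - now rewrite Nat.even_even, Nat.div2_double.
  - rewrite <- Nat.add_1_r at 1.
    now rewrite Nat.even_odd, Nat.div2_succ_double.
Qed.

Lemma def_and (P Q : (nat -> M) -> Prop) :
  definable P -> definable Q -> definable (fun e => P e /\ Q e).
Proof.
  intros HP HQ. destruct (definable_merge P Q HP HQ) as (f & h & g & H).
  exists (Fand f h), g. intro e. destruct (H e). simpl. tauto.
Qed.

Lemma def_or (P Q : (nat -> M) -> Prop) :
  definable P -> definable Q -> definable (fun e => P e \/ Q e).
Proof.
  intros HP HQ. destruct (definable_merge P Q HP HQ) as (f & h & g & H).
  exists (For f h), g. intro e. destruct (H e). simpl. tauto.
Qed.

Lemma def_imp (P Q : (nat -> M) -> Prop) :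
  definable P -> definable Q -> definable (fun e => P e -> Q e).
Proof.
  intros HP HQ. destruct (definable_merge P Q HP HQ) as (f & h & g & H).
  exists (Fimp f h), g. intro e. destruct (H e). simpl. tauto.
Qed.

Lemma def_false : definable (fun _ => False).
Proof. exists Fbot, (fun n => inl n). simpl. tauto. Qed.

Lemma def_mem (t u : (nat -> M) -> M) :
  is_term t -> is_term u -> definable (fun e => t e ∈ u e).
Proof.
  intros [s Hs] [k Hk].
  exists (Fmem 0 1), (fun n => match n with O => s | S _ => k end).
  intro e. rewrite Hs, Hk. simpl. tauto.
Qed.

Lemma def_eq (t u : (nat -> M) -> M) :
  is_term t -> is_term u -> definable (fun e => t e = u e).
Proof.
  intros [s Hs] [k Hk].
  exists (Feq 0 1), (fun n => match n with O => s | S _ => k end).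
  intro e. rewrite Hs, Hk. simpl. tauto.
Qed.

(* Slots holding the variable 0 are redirected to the freshly bound one. *)
Lemma definable_bind (Q : (nat -> M) -> M -> Prop) :
  definable (fun e => Q (fun n => e (S n)) (e 0)) ->
  exists f (g : nat -> nat + M), forall e x,
    Q e x <-> sat M (scons x (fun n => slot_val (g n) e)) f.
Proof.
  intros (f & g & H).
  exists (ren (fun n => match g n with inl O => O | _ => S n end) f),
    (fun n => match g n with inl (S i) => inl i | inl O => inl O | inr m => inr m end).
  intros e x.
  rewrite (sat_ren f _ _ (fun n => slot_val (g n) (scons x e))).
  - exact (H (scons x e)).
  - intro n. destruct (g n) as [[|i]|m] eqn:E; simpl; now rewrite ?E.
Qed.

Lemma def_all (Q : (nat -> M) -> M -> Prop) :
  definable (fun e => Q (fun n => e (S n)) (e 0)) ->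
  definable (fun e => forall x, Q e x).
Proof.
  intro H. destruct (definable_bind Q H) as (f & g & K).
  exists (Fall f), g. intro e. simpl.
  split; intros L x; apply K; apply L.
Qed.

Lemma def_ex (Q : (nat -> M) -> M -> Prop) :
  definable (fun e => Q (fun n => e (S n)) (e 0)) ->
  definable (fun e => exists x, Q e x).
Proof.
  intro H. destruct (definable_bind Q H) as (f & g & K).
  exists (Fex f), g. intro e. simpl.
  split; intros [x L]; exists x; apply K; apply L.
Qed.

End Definability.

Ltac is_term_tac :=
  first [ eexists (inl _); intro; reflexivity
        | eexists (inr _); intro; reflexivity
        | assumption
        | match goal with H : is_term ?t |- is_term (fun _ => ?t _) =>
            destruct H as [[?i|?m] H]; cbn [slot_val] in H;
            [ eexists (inl _) | eexists (inr _) ];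
            intro; rewrite H; reflexivity
          end ].

Ltac definable_step :=
  first [ apply def_and | apply def_or | apply def_imp | apply def_all
        | apply def_ex | apply def_false
        | apply def_mem; is_term_tac | apply def_eq; is_term_tac
        | match goal with H : _ |- _ => apply H; is_term_tac end ].

Ltac definable_tac :=
  cbv beta delta [iff not unique subset is_empty nonempty is_singleton is_pair
    is_union is_inter is_succ inductive_set is_opair is_prod related is_fun
    app2 Add Mul Le Lt upper_bound in_ball];
  solve [repeat definable_step].

(** * Elementary set theory in a model *)

Section Model.
Context {M : set_structure} (HM : ZF M).
Implicit Types (a b c p x y z f A B P X Y T U V W S C n m k w : M).

Lemma separation (P : M -> Prop) A :
  definable (fun e : nat -> M => P (e 0)) ->
  exists X, forall x, x ∈ X <-> x ∈ A /\ P x.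
Proof.
  intro H. destruct (definable_bind (fun _ x => P x) H) as (f & g & K).
  destruct (ZF_separation M HM f (fun n : nat => slot_val (g n) (fun _ => A)) A)
    as [X HX].
  exists X. intro x. rewrite HX. now rewrite <- (K (fun _ => A) x).
Qed.

Lemma ext x y : (forall z, z ∈ x <-> z ∈ y) -> x = y.
Proof. apply (ZF_extensionality M HM). Qed.

Lemma singleton_ex a : exists x, is_singleton x a.
Proof.
  destruct (ZF_pairing M HM a a) as [x Hx]. exists x. intro z.
  rewrite (Hx z). tauto.
Qed.

Lemma inter_ex A B : exists X, is_inter X A B.
Proof.
  destruct (separation (fun x => x ∈ B) A) as [X HX]; [definable_tac|].
  exists X. exact HX.
Qed.

Lemma binary_union_ex A B : exists X, forall z, z ∈ X <-> z ∈ A \/ z ∈ B.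
Proof.
  destruct (ZF_pairing M HM A B) as [p Hp].
  destruct (ZF_union M HM p) as [X HX].
  exists X. intro z. rewrite (HX z). split.
  - intros (a & Ha & Hz). apply Hp in Ha as [->| ->]; auto.
  - intros [Hz|Hz]; [exists A|exists B]; rewrite (Hp _); auto.
Qed.

Lemma succ_ex x : exists y, is_succ y x.
Proof.
  destruct (singleton_ex x) as [s Hs].
  destruct (binary_union_ex x s) as [y Hy].
  exists y. intro z. now rewrite (Hy z), (Hs z).
Qed.

Lemma opair_ex a b : exists p, is_opair p a b.
Proof.
  destruct (singleton_ex a) as [u Hu].
  destruct (ZF_pairing M HM a b) as [v Hv].
  destruct (ZF_pairing M HM u v) as [p Hp].
  now exists p, u, v.
Qed.

Lemma opair_unique p q a b : is_opair p a b -> is_opair q a b -> p = q.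
Proof.
  intros (u & v & Hu & Hv & Hp) (u' & v' & Hu' & Hv' & Hq).
  assert (u = u') as <- by (apply ext; intro z; now rewrite (Hu z), (Hu' z)).
  assert (v = v') as <- by (apply ext; intro z; now rewrite (Hv z), (Hv' z)).
  apply ext; intro z; now rewrite (Hp z), (Hq z).
Qed.

Lemma opair_inj p a b c d : is_opair p a b -> is_opair p c d -> a = c /\ b = d.
Proof.
  intros (u & v & Hu & Hv & Hp) (u' & v' & Hu' & Hv' & Hp').
  assert (E : a = c).
  { destruct (proj1 (Hp' u) (proj2 (Hp u) (or_introl eq_refl))) as [->| ->].
    - apply Hu'. now apply Hu.
    - symmetry. apply Hu. apply Hv'. now left. }
  subst c. split; [reflexivity|].
  assert (Eb : b = a \/ b = d).
  { assert (b ∈ v) by (apply Hv; now right).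
    destruct (proj1 (Hp' v) (proj2 (Hp v) (or_intror eq_refl))) as [->| ->].
    - left. now apply Hu'.
    - now apply Hv'. }
  assert (Ed : d = a \/ d = b).
  { assert (d ∈ v') by (apply Hv'; now right).
    destruct (proj1 (Hp v') (proj2 (Hp' v') (or_intror eq_refl))) as [->| ->].
    - left. now apply Hu.
    - now apply Hv. }
  intuition congruence.
Qed.

Lemma related_opair f p x y : is_opair p x y -> related f x y -> p ∈ f.
Proof.
  intros Hp (q & Hq & Hf). now rewrite (opair_unique p q x y Hp Hq).
Qed.

Lemma prod_ex A B : exists P, is_prod P A B.
Proof.
  destruct (binary_union_ex A B) as [Z HZ].
  destruct (ZF_power M HM Z) as [PZ HPZ].
  destruct (ZF_power M HM PZ) as [PPZ HPPZ].
  destruct (separation (fun p => exists a b, a ∈ A /\ b ∈ B /\ is_opair p a b) PPZ)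
    as [P HP]; [definable_tac|].
  exists P. intro p. rewrite HP. split; [tauto|].
  intros (a & b & Ha & Hb & H). split; [|now exists a, b].
  destruct H as (u & v & Hu & Hv & Hp).
  apply HPPZ. intros x Hx. apply HPZ. intros y Hy. apply HZ.
  apply Hp in Hx as [->| ->].
  - apply Hu in Hy as ->. auto.
  - apply Hv in Hy as [->| ->]; auto.
Qed.

Lemma fun_dom f A B a b : is_fun f A B -> related f a b -> a ∈ A /\ b ∈ B.
Proof.
  intros [Hf _] (p & Hp & Hpf).
  destruct (Hf p Hpf) as (a' & b' & Ha & Hb & Hp').
  now destruct (opair_inj p a b a' b' Hp Hp') as [-> ->].
Qed.

Lemma fun_unique f A B a b b' :
  is_fun f A B -> related f a b -> related f a b' -> b = b'.
Proof.
  intros Hf H H'. destruct (fun_dom f A B a b Hf H) as [Ha _].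
  destruct (proj2 Hf a Ha) as (c & _ & Hc).
  now rewrite <- (Hc b H), <- (Hc b' H').
Qed.

Lemma fun_ex f A B a : is_fun f A B -> a ∈ A -> exists b, b ∈ B /\ related f a b.
Proof.
  intros Hf Ha. destruct (proj2 Hf a Ha) as (b & Hb & _).
  exists b. split; [|assumption]. now apply (fun_dom f A B a b).
Qed.

Lemma fun2_dom f A B C a b c :
  is_fun2 f A B C -> app2 f a b c -> a ∈ A /\ b ∈ B /\ c ∈ C.
Proof.
  intros (P & HP & Hf) (p & Hp & Hr).
  destruct (fun_dom _ _ _ _ _ Hf Hr) as [Hin Hc].
  apply HP in Hin as (a' & b' & Ha & Hb & Hp').
  now destruct (opair_inj p a b a' b' Hp Hp') as [-> ->].
Qed.

Lemma fun2_unique f A B C a b c c' :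
  is_fun2 f A B C -> app2 f a b c -> app2 f a b c' -> c = c'.
Proof.
  intros (P & HP & Hf) (p & Hp & Hr) (q & Hq & Hr').
  rewrite (opair_unique q p a b Hq Hp) in Hr'.
  exact (fun_unique f P C p c c' Hf Hr Hr').
Qed.

Lemma fun2_ex f A B C a b :
  is_fun2 f A B C -> a ∈ A -> b ∈ B -> exists c, c ∈ C /\ app2 f a b c.
Proof.
  intros (P & HP & Hf) Ha Hb.
  destruct (opair_ex a b) as [p Hp].
  destruct (fun_ex f P C p Hf) as (c & Hc & Hr).
  { apply HP. now exists a, b. }
  exists c. split; [assumption|]. now exists p.
Qed.

(** * Natural numbers of the model *)

Lemma mem_asym x y : x ∈ y -> y ∉ x.
Proof.
  intros H H'. destruct (ZF_pairing M HM x y) as [s Hs].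
  destruct (ZF_foundation M HM s) as (z & Hz & K).
  - exists x. apply Hs. now left.
  - apply Hs in Hz as [->| ->].
    + apply (K y H'). apply Hs. now right.
    + apply (K x H). apply Hs. now left.
Qed.

Lemma empty_unique x y : is_empty x -> is_empty y -> x = y.
Proof.
  intros Hx Hy. apply ext. intro z. split; intro H;
    [elim (Hx z H)|elim (Hy z H)].
Qed.

Lemma succ_unique x y n : is_succ x n -> is_succ y n -> x = y.
Proof. intros Hx Hy. apply ext. intro z. now rewrite (Hx z), (Hy z). Qed.

Lemma succ_inj x n m : is_succ x n -> is_succ x m -> n = m.
Proof.
  intros Hn Hm.
  assert (H1 : n ∈ m \/ n = m) by (apply Hm, Hn; now right).
  assert (H2 : m ∈ n \/ m = n) by (apply Hn, Hm; now right).
  destruct H1 as [H1|H1]; [|assumption].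
  destruct H2 as [H2|H2]; [|now symmetry].
  elim (mem_asym n m H1 H2).
Qed.

Lemma omega_succ w n s : is_omega w -> n ∈ w -> is_succ s n -> s ∈ w.
Proof.
  intros [[_ Hw] _] Hn Hs. destruct (Hw n Hn) as (s' & Hs' & H).
  now rewrite (succ_unique s s' n Hs Hs').
Qed.

Lemma omega_zero w z : is_omega w -> is_empty z -> z ∈ w.
Proof.
  intros [[(z' & Hz' & H) _] _] Hz. now rewrite (empty_unique z z' Hz Hz').
Qed.

Lemma omega_ind w (P : M -> Prop) :
  is_omega w -> definable (fun e : nat -> M => P (e 0)) ->
  (forall z, is_empty z -> P z) ->
  (forall n s, n ∈ w -> P n -> is_succ s n -> P s) ->
  forall n, n ∈ w -> P n.
Proof.
  intros Hw HP H0 HS n Hn.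
  destruct (separation P w HP) as [Y HY].
  enough (n ∈ Y) by now apply HY.
  apply (proj2 Hw); [|assumption]. split.
  - destruct (proj1 (proj1 Hw)) as (z & Hz & Hzw).
    exists z. rewrite HY. auto.
  - intros m Hm. apply HY in Hm as [Hm HPm].
    destruct (proj2 (proj1 Hw) m Hm) as (s & Hs & Hsw).
    exists s. rewrite HY. eauto.
Qed.

Lemma omega_zero_le w n z : is_omega w -> n ∈ w -> is_empty z -> z = n \/ z ∈ n.
Proof.
  intros Hw Hn Hz.
  apply (omega_ind w (fun n => z = n \/ z ∈ n) Hw); try assumption.
  - definable_tac.
  - intros y Hy. left. now apply empty_unique.
  - intros m s Hm IH Hs. right. apply Hs. destruct IH as [->|IH]; auto.
Qed.

Lemma omega_succ_le w n k s :
  is_omega w -> n ∈ w -> k ∈ n -> is_succ s k -> s = n \/ s ∈ n.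
Proof.
  intros Hw Hn. revert k s.
  apply (omega_ind w
    (fun n => forall k s, k ∈ n -> is_succ s k -> s = n \/ s ∈ n) Hw);
    try assumption.
  - definable_tac.
  - intros z Hz k s Hk. elim (Hz k Hk).
  - intros m m' Hm IH Hm' k s Hk Hs. apply Hm' in Hk as [Hk| ->].
    + right. apply Hm'. destruct (IH k s Hk Hs); auto.
    + left. now apply (succ_unique s m' m).
Qed.

Lemma omega_trichotomy w n m :
  is_omega w -> n ∈ w -> m ∈ w -> m ∈ n \/ m = n \/ n ∈ m.
Proof.
  intros Hw Hn Hm. revert m Hm.
  apply (omega_ind w (fun n => forall m, m ∈ w -> m ∈ n \/ m = n \/ n ∈ m) Hw);
    try assumption.
  - definable_tac.
  - intros z Hz m Hm. destruct (omega_zero_le w m z Hw Hm Hz); auto.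
  - intros k s Hk IH Hs m Hm. destruct (IH m Hm) as [H|[H|H]].
    + left. apply Hs. now left.
    + left. apply Hs. now right.
    + destruct (omega_succ_le w m k s Hw Hm H Hs); auto.
Qed.

Lemma finite_ind x (P : M -> Prop) :
  finite_set x -> definable (fun e : nat -> M => P (e 0)) ->
  (forall z, is_empty z -> P z) ->
  (forall y a y', a ∈ x -> P y -> (forall z, z ∈ y' <-> z ∈ y \/ z = a) -> P y') ->
  P x.
Proof.
  intros (w & n & f & Hw & Hn & [[Hf _] Hsurj]) HP H0 HS.
  assert (DP : forall t : (nat -> M) -> M, is_term t -> definable (fun e => P (t e))).
  { intros t Ht.
    assert (D : definable (fun e : nat -> M => exists x, x = t e /\ P x)).
    { apply def_ex. apply def_and.
      - apply def_eq; [is_term_tac|]. destruct Ht as [[i|m] Ht].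
        + exists (inl (S i)). intro e. now rewrite Ht.
        + exists (inr m). intro e. now rewrite Ht.
      - destruct HP as (g & h & K). exists g, h. intro e. apply (K e). }
    destruct D as (g & h & K). exists g, h. intro e. rewrite <- K.
    split; [intro; eexists; eauto|now intros (? & -> & ?)]. }
  assert (Himage : forall m, m ∈ w -> subset m n ->
    forall y, (forall z, z ∈ y <-> exists i, i ∈ m /\ related f i z) -> P y).
  { apply (omega_ind w (fun m => subset m n ->
      forall y, (forall z, z ∈ y <-> exists i, i ∈ m /\ related f i z) -> P y) Hw).
    - definable_tac.
    - intros z Hz _ y Hy. apply H0. intros u Hu.
      apply Hy in Hu as (i & Hi & _). elim (Hz i Hi).
    - intros m s Hm IH Hs Hsn y Hy.
      assert (Hmn : m ∈ n) by (apply Hsn, Hs; now right).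
      destruct (fun_ex f n x m Hf Hmn) as (a & Ha & Hfa).
      destruct (separation (fun z => exists i, i ∈ m /\ related f i z) x)
        as [y0 Hy0]; [definable_tac|].
      assert (Hy0' : forall z, z ∈ y0 <-> exists i, i ∈ m /\ related f i z).
      { intro z. rewrite Hy0. split; [tauto|]. intros (i & Hi & Hz).
        split; [now apply (fun_dom f n x i z)|now exists i]. }
      apply (HS y0 a y Ha).
      + apply IH; [|assumption]. intros i Hi. apply Hsn, Hs. now left.
      + intro z. rewrite Hy, Hy0'. split.
        * intros (i & Hi & Hz). apply Hs in Hi as [Hi| ->].
          -- left. now exists i.
          -- right. exact (fun_unique f n x m z a Hf Hz Hfa).
        * intros [(i & Hi & Hz)| ->].
          -- exists i. split; [apply Hs; now left|assumption].
          -- exists m. split; [apply Hs; now right|assumption]. }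
  apply (Himage n Hn); [now intros i|].
  intro z. split.
  - intro Hz. destruct (Hsurj z Hz) as [i Hi]. exists i.
    split; [now apply (fun_dom f n x i z)|assumption].
  - intros (i & _ & Hi). now apply (fun_dom f n x i z).
Qed.

Lemma omega_recursion w Y u0 (Step : M -> M -> M -> Prop) :
  is_omega w -> u0 ∈ Y ->
  (forall t u v : (nat -> M) -> M, is_term t -> is_term u -> is_term v ->
     definable (fun e => Step (t e) (u e) (v e))) ->
  (forall n U, n ∈ w -> U ∈ Y -> exists V, V ∈ Y /\ Step n U V) ->
  (forall n U V V', Step n U V -> Step n U V' -> V = V') ->
  exists G, is_fun G w Y /\
    (forall z, is_empty z -> related G z u0) /\
    (forall n s U V, is_succ s n -> related G n U -> related G s V -> Step n U V).
Proof.
  intros Hw Hu0 DStep Hex Huniq.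
  destruct (prod_ex w Y) as [P HP].
  assert (in_prod : forall p n U, is_opair p n U -> p ∈ P -> n ∈ w /\ U ∈ Y).
  { intros p n U Hp H. apply HP in H as (n' & U' & Hn & HU & Hp').
    now destruct (opair_inj p n U n' U' Hp Hp') as [-> ->]. }
  set (closed G := (forall z, is_empty z -> related G z u0) /\
    (forall n s U V, is_succ s n -> V ∈ Y -> n ∈ w ->
       related G n U -> Step n U V -> related G s V)).
  destruct (separation (fun p => forall G, closed G -> p ∈ G) P) as [G HG].
  { unfold closed. definable_tac. }
  assert (HGrel : forall n U, related G n U <->
    (n ∈ w /\ U ∈ Y /\ forall H, closed H -> related H n U)).
  { intros n U. split.
    - intros (p & Hp & HpG). apply HG in HpG as [HpP HpG].
      destruct (in_prod p n U Hp HpP) as [Hn HU]. repeat split; try assumption.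
      intros H HH. exists p. auto.
    - intros (Hn & HU & K). destruct (opair_ex n U) as [p Hp].
      exists p. split; [assumption|]. apply HG. split.
      + apply HP. now exists n, U.
      + intros H HH. apply (related_opair H p n U Hp). auto. }
  assert (Gzero : forall z, is_empty z -> related G z u0).
  { intros z Hz. apply HGrel. split; [now apply (omega_zero w z)|].
    split; [assumption|]. intros H [H0 _]. auto. }
  assert (Gsucc : forall n s U V, is_succ s n -> V ∈ Y -> n ∈ w ->
    related G n U -> Step n U V -> related G s V).
  { intros n s U V Hs HV Hn HU HUV. apply HGrel in HU as (_ & _ & HU).
    apply HGrel. split; [now apply (omega_succ w n s)|].
    split; [assumption|]. intros H HH. apply (proj2 HH n s U V); auto. }
  assert (Ginv : forall n U, related G n U -> (is_empty n /\ U = u0) \/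
    exists m V, related G m V /\ is_succ n m /\ Step m V U).
  { destruct (separation (fun p => exists n U, is_opair p n U /\
      ((is_empty n /\ U = u0) \/
       exists m V, related G m V /\ is_succ n m /\ Step m V U)) P) as [H HH].
    { definable_tac. }
    assert (closed H).
    { split.
      - intros z Hz. destruct (opair_ex z u0) as [p Hp].
        exists p. split; [assumption|]. apply HH. split.
        + apply HP. exists z, u0. pose proof (omega_zero w z Hw Hz). auto.
        + exists z, u0. auto.
      - intros n s U V Hs HV Hn HU HUV. destruct (opair_ex s V) as [p Hp].
        exists p. split; [assumption|]. apply HH. split.
        + apply HP. exists s, V. pose proof (omega_succ w n s Hw Hn Hs). auto.
        + exists s, V. split; [assumption|]. right. exists n, U.
          split; [|auto].
          destruct HU as (q & Hq & HqH). apply HH in HqH as [HqP HqH].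
          destruct (in_prod q n U Hq HqP) as [_ HUY].
          destruct HqH as (n' & U' & Hq' & Hcase).
          destruct (opair_inj q n U n' U' Hq Hq') as [<- <-].
          destruct Hcase as [[Hz ->]|(m & W & HmW & Hsm & HWU)]; [auto|].
          apply (Gsucc m n W U); try assumption. apply HGrel in HmW. tauto. }
    intros n U HnU. apply HGrel in HnU as (_ & _ & HnU).
    destruct (HnU H H0) as (p & Hp & HpH).
    apply HH in HpH as [_ (n' & U' & Hp' & Hcase)].
    now destruct (opair_inj p n U n' U' Hp Hp') as [-> ->]. }
  assert (Guniq : forall n, n ∈ w ->
    forall U U', related G n U -> related G n U' -> U = U').
  { apply (omega_ind w (fun n => forall U U', related G n U -> related G n U' ->
      U = U') Hw).
    - definable_tac.
    - assert (K : forall z, is_empty z -> forall U, related G z U -> U = u0).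
      { intros z Hz U HU.
        destruct (Ginv z U HU) as [[_ ->]|(m & V & _ & Hs & _)]; [reflexivity|].
        elim (Hz m). apply Hs. now right. }
      intros z Hz U U' HU HU'. now rewrite (K z Hz U HU), (K z Hz U' HU').
    - intros n s Hn IH Hs.
      assert (K : forall U, related G s U ->
        exists V, related G n V /\ Step n V U).
      { intros U HU.
        destruct (Ginv s U HU) as [[Hz _]|(m & V & HmV & Hs' & HVU)].
        - elim (Hz n). apply Hs. now right.
        - rewrite <- (succ_inj s n m Hs Hs') in *. now exists V. }
      intros U U' HU HU'.
      destruct (K U HU) as (V & HV & HVU), (K U' HU') as (V' & HV' & HVU').
      rewrite (IH V' V HV' HV) in HVU'. exact (Huniq n V U U' HVU HVU'). }
  assert (Gex : forall n, n ∈ w -> exists U, related G n U).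
  { apply (omega_ind w (fun n => exists U, related G n U) Hw).
    - definable_tac.
    - intros z Hz. exists u0. auto.
    - intros n s Hn [U HU] Hs.
      destruct (Hex n U Hn) as (V & HV & HUV); [apply HGrel in HU; tauto|].
      exists V. eauto. }
  exists G. repeat split.
  - intros p Hp. apply HG in Hp as [Hp _].
    apply HP in Hp as (n & U & Hn & HU & Hp). now exists n, U.
  - intros n Hn. destruct (Gex n Hn) as [U HU].
    exists U. split; [assumption|]. eauto.
  - exact Gzero.
  - intros n s U V Hs HU HV.
    assert (Hn : n ∈ w) by (apply HGrel in HU; tauto).
    assert (HUY : U ∈ Y) by (apply HGrel in HU; tauto).
    destruct (Hex n U Hn HUY) as (V' & HV' & HUV').
    rewrite (Guniq s (omega_succ w n s Hw Hn Hs) V V' HV); [assumption|].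
    eauto.
Qed.

(** * Ordered field arithmetic *)

Section Field.
Context (F : field_data M) (HF : complete_ordered_field F).
Implicit Types (r s t u v : M).
Local Notation R := (R_set F).
Local Notation zero := (R_zero F).
Local Notation one := (R_one F).

Lemma Add_dom x y z : Add F x y z -> x ∈ R /\ y ∈ R /\ z ∈ R.
Proof. apply fun2_dom, R_add_fun, HF. Qed.

Lemma Add_unique x y z z' : Add F x y z -> Add F x y z' -> z = z'.
Proof. exact (fun2_unique _ _ _ _ _ _ _ _ (R_add_fun F HF)). Qed.

Lemma Add_ex x y : x ∈ R -> y ∈ R -> exists z, z ∈ R /\ Add F x y z.
Proof. exact (fun2_ex _ _ _ _ _ _ (R_add_fun F HF)). Qed.

Lemma Mul_ex x y : x ∈ R -> y ∈ R -> exists z, z ∈ R /\ Mul F x y z.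
Proof. exact (fun2_ex _ _ _ _ _ _ (R_mul_fun F HF)). Qed.

Lemma Le_refl x : x ∈ R -> Le F x x.
Proof. intro Hx. now destruct (R_le_total F HF x x Hx Hx). Qed.

Lemma Lt_or_Le x y : x ∈ R -> y ∈ R -> Lt F x y \/ Le F y x.
Proof.
  intros Hx Hy. destruct (R_le_total F HF x y Hx Hy) as [H|H]; [|auto].
  destruct (classic (x = y)) as [->|Hne]; [auto|]. left. now split.
Qed.

Lemma Lt_not_Le x y : x ∈ R -> y ∈ R -> Lt F x y -> ~ Le F y x.
Proof. intros Hx Hy [H Hne] H'. apply Hne. now apply (R_le_antisym F HF). Qed.

Lemma Le_Lt_trans x y z : x ∈ R -> y ∈ R -> z ∈ R ->
  Le F x y -> Lt F y z -> Lt F x z.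
Proof.
  intros Hx Hy Hz Hxy Hyz.
  destruct (Lt_or_Le x z Hx Hz) as [H|H]; [assumption|].
  elim (Lt_not_Le y z Hy Hz Hyz). now apply (R_le_trans F HF z x y).
Qed.

Lemma Lt_Le_trans x y z : x ∈ R -> y ∈ R -> z ∈ R ->
  Lt F x y -> Le F y z -> Lt F x z.
Proof.
  intros Hx Hy Hz Hxy Hyz.
  destruct (Lt_or_Le x z Hx Hz) as [H|H]; [assumption|].
  elim (Lt_not_Le x y Hx Hy Hxy). now apply (R_le_trans F HF y z x).
Qed.

Lemma Add_cancel x y z s : Add F x z s -> Add F y z s -> x = y.
Proof.
  intros Hx Hy.
  destruct (Add_dom _ _ _ Hx) as (HxR & HzR & HsR).
  destruct (Add_dom _ _ _ Hy) as (HyR & _ & _).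
  destruct (R_add_opp F HF z HzR) as (n & HnR & Hn).
  destruct (Add_ex s n HsR HnR) as (u & _ & Hu).
  rewrite (Add_unique x zero x u); [| now apply (R_add_zero F HF)|].
  - symmetry. apply (Add_unique y zero); [now apply (R_add_zero F HF)|].
    exact (R_add_assoc F HF y z n s zero u Hy Hu Hn).
  - exact (R_add_assoc F HF x z n s zero u Hx Hu Hn).
Qed.

Lemma Add_lt_mono x y z s t :
  Lt F x y -> Add F x z s -> Add F y z t -> Lt F s t.
Proof.
  intros [Hle Hne] Hs Ht. split.
  - apply (R_le_add F HF x y z s t); try assumption;
      [apply (Add_dom _ _ _ Hs)|apply (Add_dom _ _ _ Ht)].
  - intros <-. apply Hne. exact (Add_cancel x y z s Hs Ht).
Qed.

Lemma Add_lt_mono2 a b r u m :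
  Lt F a r -> Lt F b r -> r ∈ R -> Add F a b u -> Add F r r m -> Lt F u m.
Proof.
  intros Ha Hb Hr Hu Hm.
  destruct (Add_dom _ _ _ Hu) as (HaR & HbR & HuR).
  destruct (Add_dom _ _ _ Hm) as (_ & _ & HmR).
  destruct (Add_ex r b Hr HbR) as (v & HvR & Hv).
  apply (Lt_Le_trans u v m HuR HvR HmR).
  - exact (Add_lt_mono a r b u v Ha Hu Hv).
  - apply (R_add_comm F HF) in Hv. apply (Add_lt_mono b r r v m Hb Hv Hm).
Qed.

Lemma difference_pos t s : t ∈ R -> s ∈ R -> Lt F t s ->
  exists u, u ∈ R /\ Lt F zero u /\ Add F t u s.
Proof.
  intros Ht Hs Hts.
  destruct (R_add_opp F HF t Ht) as (n & Hn & Htn).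
  destruct (Add_ex s n Hs Hn) as (u & Hu & Hsn).
  exists u. split; [assumption|].
  assert (Hut : Add F u t s).
  { destruct (Add_ex u t Hu Ht) as (s' & _ & H).
    enough (s' = s) as <- by assumption.
    apply (Add_unique s zero); [|now apply (R_add_zero F HF)].
    apply (R_add_assoc F HF s n t u zero s'); try assumption.
    now apply (R_add_comm F HF). }
  split; [|now apply (R_add_comm F HF)].
  exact (Add_lt_mono t s n zero u Hts Htn Hsn).
Qed.

Lemma half_ex s : s ∈ R -> exists r, r ∈ R /\ Add F r r s.
Proof.
  intro Hs.
  pose proof (R_one_mem F HF) as H1. pose proof (R_zero_mem F HF) as H0.
  pose proof (R_zero_neq_one F HF) as H01.
  pose proof (R_add_comm F HF _ _ _ (R_add_zero F HF one H1)) as H011.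
  destruct (Add_ex one one H1 H1) as (two & H2 & H112).
  assert (H20 : two <> zero).
  { intros ->. apply H01.
    assert (Lt F zero one \/ Lt F one zero) as [H|H].
    { destruct (R_le_total F HF zero one H0 H1);
        [left|right]; split; auto. }
    - pose proof (Add_lt_mono zero one one one zero H H011 H112) as [K _].
      apply (R_le_antisym F HF); auto. apply H.
    - pose proof (Add_lt_mono one zero one zero one H H112 H011) as [K _].
      apply (R_le_antisym F HF); auto. apply H. }
  destruct (R_mul_inv F HF two H2 H20) as (h & Hh & H2h).
  pose proof (R_mul_one F HF h Hh) as Hh1.
  pose proof (R_distr F HF h one one two one h h H112
    (R_mul_comm F HF _ _ _ H2h) Hh1 Hh1) as Hhh.
  destruct (Mul_ex s h Hs Hh) as (r & Hr & Hshr).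
  exists r. split; [assumption|].
  exact (R_distr F HF s h h one s r r Hhh (R_mul_one F HF s Hs) Hshr Hshr).
Qed.

Lemma half_pos_lt r s : Add F r r s -> Lt F zero s -> Lt F zero r /\ Lt F r s.
Proof.
  intros Hrs Hs.
  destruct (Add_dom _ _ _ Hrs) as (Hr & _ & HsR).
  pose proof (R_zero_mem F HF) as H0.
  pose proof (R_add_comm F HF _ _ _ (R_add_zero F HF r Hr)) as H0r.
  assert (Hpos : Lt F zero r).
  { destruct (Lt_or_Le zero r H0 Hr) as [H|H]; [assumption|].
    elim (Lt_not_Le zero s H0 HsR Hs).
    apply (R_le_trans F HF s r zero); try assumption.
    exact (R_le_add F HF r zero r s r Hr H0 H Hrs H0r). }
  split; [assumption|]. exact (Add_lt_mono zero r r r s Hpos H0r Hrs).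
Qed.

Lemma half_unique r r' s : Add F r r s -> Add F r' r' s -> r = r'.
Proof.
  assert (K : forall r r', Lt F r r' -> Add F r r s -> ~ Add F r' r' s).
  { intros a b Hab Ha Hb.
    destruct (Add_dom _ _ _ Hb) as (HbR & _ & _).
    now destruct (Add_lt_mono2 a a b s s Hab Hab HbR Ha Hb). }
  intros H H'.
  destruct (Add_dom _ _ _ H) as (Hr & _ & _).
  destruct (Add_dom _ _ _ H') as (Hr' & _ & _).
  destruct (Lt_or_Le r r' Hr Hr') as [L|L]; [elim (K r r' L H H')|].
  apply NNPP. intro Hne. apply (K r' r); auto. split; auto.
Qed.

End Field.

(** * Dense-in-itself subsets of compact metric spaces *)

Section Metric.
Context (F : field_data M) (HF : complete_ordered_field F).
Context (X T d : M) (HT : topology X T) (Hd : metric F X d).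
Context (Hopen : forall U, U ∈ T <-> metric_open F X d U).
Implicit Types (r s t u v O : M).
Local Notation R := (R_set F).
Local Notation zero := (R_zero F).

Lemma open_subset U : U ∈ T -> subset U X.
Proof. apply HT. Qed.

Lemma open_inter U V W : U ∈ T -> V ∈ T -> is_inter W U V -> W ∈ T.
Proof. apply HT. Qed.

Lemma dist_dom x y t : app2 d x y t -> x ∈ X /\ y ∈ X /\ t ∈ R.
Proof. exact (fun2_dom _ _ _ _ _ _ _ (metric_fun F X d Hd)). Qed.

Lemma dist_ex x y : x ∈ X -> y ∈ X -> exists t, t ∈ R /\ app2 d x y t.
Proof. exact (fun2_ex _ _ _ _ _ _ (metric_fun F X d Hd)). Qed.

Lemma in_ball_center x s : x ∈ X -> Lt F zero s -> in_ball F d x s x.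
Proof.
  intros Hx Hs. exists zero. split; [|assumption].
  now apply (metric_zero F X d Hd).
Qed.

Lemma in_ball_sym x y s : in_ball F d x s y -> in_ball F d y s x.
Proof.
  intros (t & Ht & Hts). exists t. split; [|assumption].
  now apply (metric_sym F X d Hd).
Qed.

Lemma in_ball_le x y r s : r ∈ R -> s ∈ R -> Le F r s ->
  in_ball F d x r y -> in_ball F d x s y.
Proof.
  intros Hr Hs Hrs (t & Ht & Htr). exists t. split; [assumption|].
  apply (Lt_Le_trans F HF t r s); try assumption. apply (dist_dom x y t Ht).
Qed.

Lemma in_ball_dom x y s : in_ball F d x s y -> x ∈ X /\ y ∈ X.
Proof. intros (t & Ht & _). destruct (dist_dom x y t Ht) as (? & ? & _). auto. Qed.

Lemma in_ball_trans x y z r m :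
  r ∈ R -> Add F r r m -> in_ball F d x r y -> in_ball F d y r z ->
  in_ball F d x m z.
Proof.
  intros Hr Hm (a & Ha & Har) (b & Hb & Hbr).
  destruct (dist_dom x y a Ha) as (Hx & _ & HaR).
  destruct (dist_dom y z b Hb) as (_ & Hz & HbR).
  destruct (dist_ex x z Hx Hz) as (t & HtR & Ht).
  destruct (Add_ex F HF a b HaR HbR) as (u & HuR & Hu).
  exists t. split; [assumption|].
  apply (Le_Lt_trans F HF t u m); try assumption.
  - apply (Add_dom F HF r r m Hm).
  - exact (metric_triangle F X d Hd x y z a b t u Ha Hb Ht Hu).
  - exact (Add_lt_mono2 F HF a b r u m Har Hbr Hr Hu Hm).
Qed.

Lemma ball_open x s : x ∈ X -> s ∈ R ->
  exists O, O ∈ T /\ forall y, y ∈ O <-> in_ball F d x s y.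
Proof.
  intros Hx Hs.
  destruct (separation (fun y => in_ball F d x s y) X) as [O HO].
  { definable_tac. }
  assert (HO' : forall y, y ∈ O <-> in_ball F d x s y).
  { intro y. rewrite HO. split; [tauto|]. intro H. split; [|assumption].
    now apply (in_ball_dom x y s). }
  exists O. split; [|assumption]. apply Hopen. split.
  { intros y Hy. now apply HO in Hy. }
  intros y Hy. apply HO' in Hy as (t & Ht & Hts).
  destruct (dist_dom x y t Ht) as (_ & HyX & HtR).
  destruct (difference_pos F HF t s HtR Hs Hts) as (u & Hu & Hu0 & Htu).
  exists u. split; [assumption|]. split; [assumption|].
  intros z Hz (b & Hb & Hbu). apply HO'.
  destruct (dist_dom y z b Hb) as (_ & _ & HbR).
  destruct (dist_ex x z Hx Hz) as (a & HaR & Ha).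
  destruct (Add_ex F HF t b HtR HbR) as (v & HvR & Hv).
  exists a. split; [assumption|].
  apply (Le_Lt_trans F HF a v s); try assumption.
  - exact (metric_triangle F X d Hd x y z t b a v Ht Hb Ha Hv).
  - apply (Add_lt_mono F HF b u t v s Hbu); now apply (R_add_comm F HF).
Qed.

Lemma compl_point_open c : c ∈ X ->
  exists O, O ∈ T /\ forall y, y ∈ O <-> y ∈ X /\ y <> c.
Proof.
  intro Hc.
  destruct (separation (fun y => y <> c) X) as [O HO]; [definable_tac|].
  exists O. split; [|assumption]. apply Hopen. split.
  { intros y Hy. now apply HO in Hy. }
  intros y Hy. apply HO in Hy as [Hy Hne].
  destruct (dist_ex y c Hy Hc) as (t & HtR & Ht).
  exists t. split; [assumption|]. split.
  { split; [exact (metric_nonneg F X d Hd y c t Ht)|].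
    intros <-. apply Hne. now apply (metric_zero F X d Hd). }
  intros z Hz (t' & Ht' & Hlt). apply HO. split; [assumption|].
  intros ->. apply (proj2 Hlt).
  exact (fun2_unique _ _ _ _ _ _ _ _ (metric_fun F X d Hd) Ht' Ht).
Qed.

Section Perfect.
Context (S w : M) (HSX : subset S X) (HSne : nonempty S).
Context (HSperf : forall U p, U ∈ T -> p ∈ U -> p ∈ S ->
  exists q, q ∈ U /\ q ∈ S /\ q <> p).
Context (Hw : is_omega w).

Definition meets U : Prop := exists p, p ∈ U /\ p ∈ S.

Lemma remove_point U c : U ∈ T -> meets U ->
  exists V, V ∈ T /\ subset V U /\ meets V /\ c ∉ V.
Proof.
  intros HU (p & HpU & HpS).
  destruct (classic (c ∈ X)) as [Hc|Hc].
  2:{ exists U. split; [assumption|]. split; [now intros x|].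
      split; [now exists p|]. intro H. apply Hc. now apply (open_subset U). }
  destruct (compl_point_open c Hc) as (O & HO & HOc).
  destruct (inter_ex U O) as [V HV].
  exists V. split; [now apply (open_inter U O V)|].
  split; [intros x Hx; now apply HV in Hx|].
  split; [|intro H; apply HV, proj2, HOc in H; tauto].
  assert (exists q, q ∈ U /\ q ∈ S /\ q <> c) as (q & HqU & HqS & Hqc).
  { destruct (classic (p = c)) as [->|Hne]; [now apply HSperf|now exists p]. }
  exists q. split; [|assumption]. apply HV. split; [assumption|].
  apply HOc. auto.
Qed.

Lemma remove_finite a U : finite_set a -> U ∈ T -> meets U ->
  exists V, V ∈ T /\ subset V U /\ meets V /\ forall x, x ∈ V -> x ∉ a.
Proof.
  intros Ha. revert U. pattern a. apply (finite_ind a); [assumption| | |].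
  - unfold meets. definable_tac.
  - intros z Hz U HU HUS. exists U. split; [assumption|].
    split; [now intros x|]. split; [assumption|]. intros x _. apply Hz.
  - intros y c y' Hc IH Hy' U HU HUS.
    destruct (IH U HU HUS) as (V & HV & HVU & HVS & HVy).
    destruct (remove_point V c HV HVS) as (W & HW & HWV & HWS & HWc).
    exists W. split; [assumption|]. split; [intros x Hx; auto|].
    split; [assumption|]. intros x Hx Hxy. apply Hy' in Hxy as [Hxy| ->].
    + exact (HVy x (HWV x Hx) Hxy).
    + exact (HWc Hx).
Qed.

(* [bad n] is the [n]-th piece of a cover of [X]; it is kept as a definable
   class so that the same argument serves cuf and countable spaces. *)
Context (bad : M -> M -> Prop).
Context (Dbad : forall t u : (nat -> M) -> M, is_term t -> is_term u ->
  definable (fun e => bad (t e) (u e))).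
Context (Hcover : forall x, x ∈ X -> exists n, n ∈ w /\ bad n x).
Context (Hremove : forall n U, n ∈ w -> U ∈ T -> meets U ->
  exists V, V ∈ T /\ subset V U /\ meets V /\ forall x, x ∈ V -> ~ bad n x).
Context (c : M) (HcR : c ∈ R) (Hc : Lt F zero c).

(* [x] is interior to the set of points at distance at least [r] from the
   complement of [U \ bad n]. *)
Definition deep r n U x : Prop :=
  exists O, O ∈ T /\ x ∈ O /\
    forall y z, y ∈ O -> z ∈ X -> in_ball F d y r z -> z ∈ U /\ ~ bad n z.

Definition good_radius n U r : Prop :=
  r ∈ R /\ Lt F zero r /\ Le F r c /\ exists x, x ∈ S /\ deep r n U x.

(* The radius, half of the supremum of the good radii, is canonical: this is
   what makes the recursion choice-free.  The bound [c] keeps it finite. *)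
Definition shrink n U V : Prop :=
  exists s r, s ∈ R /\ (forall q, good_radius n U q -> Le F q s) /\
    (forall b, b ∈ R -> (forall q, good_radius n U q -> Le F q b) -> Le F s b) /\
    Add F r r s /\ (forall x, x ∈ V <-> deep r n U x).

Lemma deep_le r s n U x : r ∈ R -> s ∈ R -> Le F r s ->
  deep s n U x -> deep r n U x.
Proof.
  intros Hr Hs Hrs (O & HO & HxO & H). exists O. repeat split; try assumption;
    apply (H y z); try assumption; now apply (in_ball_le y z r s).
Qed.

Lemma shrink_definable (t u v : (nat -> M) -> M) :
  is_term t -> is_term u -> is_term v ->
  definable (fun e => shrink (t e) (u e) (v e)).
Proof.
  intros Ht Hu Hv. unfold shrink, good_radius, deep. definable_tac.
Qed.

Lemma shrink_unique n U V V' : shrink n U V -> shrink n U V' -> V = V'.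
Proof.
  intros (s & r & Hs & Hub & Hlub & Hr & HV) (s' & r' & Hs' & Hub' & Hlub' & Hr' & HV').
  assert (s' = s) as -> by (apply (R_le_antisym F HF); auto).
  rewrite (half_unique F HF r' r s Hr' Hr) in HV'.
  apply ext. intro x. now rewrite HV, HV'.
Qed.

Lemma good_radius_ex n U : n ∈ w -> U ∈ T -> meets U ->
  exists r, good_radius n U r.
Proof.
  intros Hn HU HUS.
  destruct (Hremove n U Hn HU HUS) as (V & HV & HVU & (p & HpV & HpS) & HVbad).
  destruct (proj2 (proj1 (Hopen V) HV) p HpV) as (t & HtR & Ht & Hball).
  assert (exists m, m ∈ R /\ Lt F zero m /\ Le F m t /\ Le F m c)
    as (m & HmR & Hm & Hmt & Hmc).
  { destruct (R_le_total F HF t c HtR HcR) as [H|H].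
    - exists t. pose proof (Le_refl F HF t HtR). auto.
    - exists c. pose proof (Le_refl F HF c HcR). auto. }
  destruct (half_ex F HF m HmR) as (r & HrR & Hr).
  destruct (half_pos_lt F HF r m Hr Hm) as [Hr0 Hrm].
  exists r. split; [assumption|]. split; [assumption|].
  split; [now apply (R_le_trans F HF r m c); try apply Hrm|].
  exists p. split; [assumption|].
  destruct (ball_open p r (HSX p HpS) HrR) as (O & HO & HOball).
  exists O. split; [assumption|].
  split; [apply HOball, in_ball_center; auto|].
  intros y z Hy Hz Hyz. apply HOball in Hy.
  assert (z ∈ V).
  { apply Hball; [assumption|]. apply (in_ball_le p z m t); try assumption.
    now apply (in_ball_trans p y z r m). }
  split; [auto|now apply HVbad].
Qed.

Lemma shrink_spec n U : n ∈ w -> U ∈ T -> meets U ->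
  exists V, V ∈ T /\ meets V /\ shrink n U V.
Proof.
  intros Hn HU HUS.
  destruct (good_radius_ex n U Hn HU HUS) as [q0 Hq0].
  destruct (separation (fun q => good_radius n U q) R) as [L HL].
  { unfold good_radius, deep. definable_tac. }
  destruct (R_complete F HF L) as (s & [Hs Hub] & Hlub).
  - intros q Hq. now apply HL in Hq.
  - exists q0. apply HL. split; [apply Hq0|assumption].
  - exists c. split; [assumption|]. intros q Hq. apply HL in Hq. apply Hq.
  - assert (HubL : forall q, good_radius n U q -> Le F q s).
    { intros q Hq. apply Hub, HL. split; [apply Hq|assumption]. }
    assert (HlubL : forall b, b ∈ R -> (forall q, good_radius n U q -> Le F q b) ->
      Le F s b).
    { intros b Hb H. apply Hlub. split; [assumption|].
      intros q Hq. apply HL in Hq. now apply H. }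
    assert (Hs0 : Lt F zero s).
    { apply (Lt_Le_trans F HF zero q0 s); try apply Hq0; auto.
      apply (R_zero_mem F HF). }
    destruct (half_ex F HF s Hs) as (r & HrR & Hr).
    destruct (half_pos_lt F HF r s Hr Hs0) as [Hr0 Hrs].
    destruct (separation (fun x => deep r n U x) X) as [V HV].
    { unfold deep. definable_tac. }
    assert (HV' : forall x, x ∈ V <-> deep r n U x).
    { intro x. rewrite HV. split; [tauto|]. intro H. split; [|assumption].
      destruct H as (O & HO & Hx & _). now apply (open_subset O). }
    exists V. split; [|split].
    + destruct (separation (fun O => forall y z, y ∈ O -> z ∈ X ->
        in_ball F d y r z -> z ∈ U /\ ~ bad n z) T) as [C HC]; [definable_tac|].
      destruct HT as (_ & _ & _ & _ & Hunion). apply (Hunion C).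
      * intros O HO. now apply HC in HO.
      * intro x. rewrite HV'. split.
        -- intros (O & HO & Hx & H). exists O. rewrite HC. auto.
        -- intros (O & HO & Hx). apply HC in HO as [HO H]. now exists O.
    + apply NNPP. intro Hno.
      apply (Lt_not_Le F HF r s HrR Hs Hrs). apply HlubL; [assumption|].
      intros q Hq. destruct Hq as (HqR & Hq0' & Hqc & x & HxS & Hx).
      destruct (Lt_or_Le F HF r q HrR HqR) as [H|H]; [|assumption].
      elim Hno. exists x. split; [|assumption]. apply HV'.
      apply (deep_le r q); try assumption. apply H.
    + now exists s, r.
Qed.

Lemma shrink_separated n U V z :
  n ∈ w -> U ∈ T -> meets U -> shrink n U V -> z ∈ X -> ~ (z ∈ U /\ ~ bad n z) ->
  exists O, O ∈ T /\ z ∈ O /\ forall y, y ∈ O -> y ∉ V.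
Proof.
  intros Hn HU HUS (s & r & Hs & Hub & _ & Hr & HV) Hz Hout.
  destruct (good_radius_ex n U Hn HU HUS) as [q Hq].
  assert (Hs0 : Lt F zero s).
  { apply (Lt_Le_trans F HF zero q s); try apply Hq; auto.
    apply (R_zero_mem F HF). }
  destruct (half_pos_lt F HF r s Hr Hs0) as [Hr0 _].
  destruct (Add_dom F HF _ _ _ Hr) as (HrR & _ & _).
  destruct (ball_open z r Hz HrR) as (O & HO & HOball).
  exists O. split; [assumption|].
  split; [now apply HOball, in_ball_center|].
  intros y Hy HyV. apply HOball, in_ball_sym in Hy.
  apply HV in HyV as (O' & _ & HyO' & H). apply Hout. now apply (H y z).
Qed.

Lemma perfect_not_compact : ~ compact X T.
Proof.
  intro Hcomp.
  destruct (separation meets T) as [Y HY].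
  { unfold meets. definable_tac. }
  assert (HXY : X ∈ Y).
  { apply HY. split; [apply HT|]. destruct HSne as [p Hp]. exists p. auto. }
  destruct (omega_recursion w Y X shrink Hw HXY shrink_definable)
    as (G & HG & HG0 & HGS).
  { intros n U Hn HU. apply HY in HU as [HU HUS].
    destruct (shrink_spec n U Hn HU HUS) as (V & HV & HVS & H).
    exists V. split; [|assumption]. now apply HY. }
  { exact shrink_unique. }
  assert (HGdom : forall n U, related G n U -> n ∈ w /\ U ∈ T /\ meets U).
  { intros n U H. destruct (fun_dom G w Y n U HG H) as [Hn HU].
    apply HY in HU. tauto. }
  assert (Hnested : forall m, m ∈ w -> forall n U V, n ∈ m ->
    related G n U -> related G m V -> subset V U).
  { apply (omega_ind w (fun m => forall n U V, n ∈ m ->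
      related G n U -> related G m V -> subset V U) Hw).
    - definable_tac.
    - intros z Hz n U V Hn. elim (Hz n Hn).
    - intros m m' Hm IH Hm' n U V Hn HU HV.
      destruct (fun_ex G w Y m HG Hm) as (W & _ & HW).
      destruct (HGdom m W HW) as (_ & HWT & HWS).
      assert (HVW : subset V W).
      { intros z Hz. apply NNPP. intro HzW.
        destruct (shrink_separated m W V z Hm HWT HWS
          (HGS m m' W V Hm' HW HV)) as (O & _ & HzO & HOV).
        - apply (open_subset V); [apply (HGdom m' V HV)|assumption].
        - tauto.
        - exact (HOV z HzO Hz). }
      apply Hm' in Hn as [Hn| ->].
      + intros z Hz. apply (IH n U W Hn HU HW). auto.
      + now rewrite (fun_unique G w Y m U W HG HU HW). }
  destruct (separation (fun O => exists n U, related G n U /\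
    forall y, y ∈ O -> y ∉ U) T) as [C HC]; [definable_tac|].
  destruct (Hcomp C) as (C' & HC'C & HC'fin & HC'X).
  { intros O HO. now apply HC in HO. }
  { intro x. split.
    - intro Hx. destruct (Hcover x Hx) as (n & Hn & Hbad).
      destruct (fun_ex G w Y n HG Hn) as (U & _ & HU).
      destruct (succ_ex n) as [n' Hn'].
      destruct (fun_ex G w Y n' HG (omega_succ w n n' Hw Hn Hn'))
        as (V & _ & HV).
      destruct (HGdom n U HU) as (_ & HUT & HUS).
      destruct (shrink_separated n U V x Hn HUT HUS (HGS n n' U V Hn' HU HV) Hx)
        as (O & HO & HxO & HOV); [tauto|].
      exists O. split; [|assumption]. apply HC. split; [assumption|].
      now exists n', V.
    - intros (O & HO & Hx). apply HC in HO as [HO _].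
      now apply (open_subset O). }
  assert (exists n, n ∈ w /\ forall O U y,
    O ∈ C' -> O ∈ C -> related G n U -> y ∈ O -> y ∉ U) as (n & Hn & Hdisj).
  { apply (finite_ind C' (fun E => exists n, n ∈ w /\ forall O U y,
      O ∈ E -> O ∈ C -> related G n U -> y ∈ O -> y ∉ U) HC'fin).
    - definable_tac.
    - intros z Hz. destruct (proj1 (proj1 Hw)) as (n & _ & Hn).
      exists n. split; [assumption|]. intros O U y HO. elim (Hz O HO).
    - intros E O0 E' HO0 (n & Hn & IH) HE'.
      apply HC'C, HC in HO0 as [_ (m & V & HV & HOV)].
      destruct (HGdom m V HV) as (Hm & _).
      destruct (fun_ex G w Y n HG Hn) as (U & _ & HU).
      assert (exists k W, k ∈ w /\ related G k W /\ subset W U /\ subset W V)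
        as (k & W & Hk & HW & HWU & HWV).
      { destruct (omega_trichotomy w n m Hw Hn Hm) as [H|[->|H]].
        - exists n, U. repeat split; auto; [now intros x|].
          now apply (Hnested n Hn m V U).
        - rewrite (fun_unique G w Y n V U HG HV HU).
          exists n, U. repeat split; auto; now intros x.
        - exists m, V. repeat split; auto; [|now intros x].
          now apply (Hnested m Hm n U V). }
      exists k. split; [assumption|]. intros O W' y HO HOC HW' Hy HyW.
      rewrite (fun_unique G w Y k W' W HG HW' HW) in HyW.
      apply HE' in HO as [HO| ->].
      + exact (IH O U y HO HOC HU Hy (HWU y HyW)).
      + exact (HOV y Hy (HWV y HyW)). }
  destruct (fun_ex G w Y n HG Hn) as (U & _ & HU).
  destruct (HGdom n U HU) as (_ & _ & p & HpU & HpS).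
  destruct (proj1 (HC'X p) (HSX p HpS)) as (O & HO & HpO).
  exact (Hdisj O U p HO (HC'C O HO) HU HpO HpU).
Qed.

End Perfect.
End Metric.

Lemma finite_singleton a c : is_singleton a c -> finite_set a.
Proof.
  intro Ha.
  destruct (ZF_infinity M HM) as [y Hy].
  destruct (separation (fun n => forall x, inductive_set x -> n ∈ x) y)
    as [w Hw]; [definable_tac|].
  assert (Homega : is_omega w).
  { split; [split|].
    - destruct Hy as [(z & Hz & Hzy) _]. exists z. split; [assumption|].
      apply Hw. split; [assumption|]. intros x [(z' & Hz' & Hzx) _].
      now rewrite (empty_unique z z' Hz Hz').
    - intros n Hn. apply Hw in Hn as [Hny Hn].
      destruct (proj2 Hy n Hny) as (s & Hs & Hsy).
      exists s. split; [assumption|]. apply Hw. split; [assumption|].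
      intros x Hx. destruct (proj2 Hx n (Hn x Hx)) as (s' & Hs' & Hsx).
      now rewrite (succ_unique s s' n Hs Hs').
    - intros x Hx n Hn. apply Hw in Hn as [_ Hn]. auto. }
  destruct (proj1 (proj1 Homega)) as (z & Hz & Hzw).
  destruct (succ_ex z) as [n Hn].
  destruct (opair_ex z c) as [p Hp].
  destruct (singleton_ex p) as [f Hf].
  assert (Hnz : forall i, i ∈ n <-> i = z).
  { intro i. rewrite (Hn i). split; [|auto].
    intros [H|H]; [elim (Hz i H)|assumption]. }
  assert (Hrel : forall i b, related f i b <-> i = z /\ b = c).
  { intros i b. split.
    - intros (q & Hq & Hqf). apply Hf in Hqf as ->.
      exact (opair_inj p i b z c Hq Hp).
    - intros [-> ->]. exists p. split; [assumption|]. now apply Hf. }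
  exists w, n, f. split; [assumption|].
  split; [now apply (omega_succ w z n)|].
  split; [split; [split|]|].
  - intros q Hq. apply Hf in Hq as ->. exists z, c.
    rewrite (Hnz z), (Ha c). auto.
  - intros i Hi. apply Hnz in Hi as ->. exists c. split.
    + now apply Hrel.
    + intros b Hb. apply Hrel in Hb. now symmetry.
  - intros i j b Hi Hj. apply Hrel in Hi, Hj. intuition congruence.
  - intros b Hb. apply Ha in Hb as ->. exists z. now apply Hrel.
Qed.

Lemma scattered_of_finite_cover X T w (bad : M -> M -> Prop) :
  topology X T -> compact X T -> metrizable X T -> is_omega w ->
  (forall t u : (nat -> M) -> M, is_term t -> is_term u ->
     definable (fun e => bad (t e) (u e))) ->
  (forall x, x ∈ X -> exists n, n ∈ w /\ bad n x) ->
  (forall n, n ∈ w -> (exists x, bad n x) ->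
     exists a, finite_set a /\ forall x, bad n x -> x ∈ a) ->
  scattered X T.
Proof.
  intros HT Hcomp (F & d & HF & Hd & Hopen) Hw Dbad Hcover Hfin S TS [HSX HTS] HSne.
  apply NNPP. intro Hno.
  assert (HSperf : forall U p, U ∈ T -> p ∈ U -> p ∈ S ->
    exists q, q ∈ U /\ q ∈ S /\ q <> p).
  { intros U p HU HpU HpS. apply NNPP. intro H. apply Hno.
    destruct (inter_ex U S) as [V HV].
    exists p. split; [assumption|]. exists V. split.
    - apply HTS. now exists U.
    - intro q. rewrite (HV q). split; [|now intros ->].
      intros [HqU HqS]. apply NNPP. intro Hne. apply H. now exists q. }
  destruct HSne as [p Hp].
  destruct (proj1 (Hopen X)) as [_ HX]; [apply HT|].
  destruct (HX p (HSX p Hp)) as (c & HcR & Hc & _).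
  apply (perfect_not_compact F HF X T d HT Hd Hopen S w HSX (ex_intro _ p Hp)
    Hw bad Dbad Hcover) with (c := c); try assumption.
  intros n U Hn HU HUS.
  destruct (classic (exists x, bad n x)) as [Hbad|Hbad].
  - destruct (Hfin n Hn Hbad) as (a & Ha & Hba).
    destruct (remove_finite F X T d HT Hd Hopen S HSX HSperf a U Ha HU HUS)
      as (V & HV & HVU & HVS & HVa).
    exists V. repeat split; auto. intros x Hx Hbx. exact (HVa x Hx (Hba x Hbx)).
  - exists U. split; [assumption|]. split; [now intros x|].
    split; [assumption|]. intros x _ Hx. apply Hbad. now exists x.
Qed.

End Model.

Theorem theorem4p5 :
  forall M : set_structure, ZF M ->
    (forall X T : M,
       topology X T -> compact X T -> metrizable X T -> cuf X ->
       scattered X T) /\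
    (forall X T : M,
       topology X T -> compact X T -> metrizable X T -> countable_set X ->
       scattered X T).
Proof.
  intros M HM. split; intros X T HT Hcomp Hmet.
  - intros (A & (w & f & Hw & Hf & Hinj) & Hfin & HX).
    apply (scattered_of_finite_cover HM X T w
      (fun n x => exists a, a ∈ A /\ related f a n /\ x ∈ a)); try assumption.
    + intros t u Ht Hu. definable_tac.
    + intros x Hx. apply HX in Hx as (a & Ha & Hx).
      destruct (fun_ex f A w a Hf Ha) as (n & Hn & Hfa).
      exists n. split; [assumption|]. now exists a.
    + intros n _ (_ & a & Ha & Hfa & _). exists a. split; [auto|].
      intros x (b & _ & Hfb & Hx). now rewrite (Hinj a b n Hfa Hfb).
  - intros (w & f & Hw & Hf & Hinj).
    apply (scattered_of_finite_cover HM X T w (fun n x => related f x n));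
      try assumption.
    + intros t u Ht Hu. definable_tac.
    + intros x Hx. destruct (fun_ex f X w x Hf Hx) as (n & Hn & Hfx).
      now exists n.
    + intros n _ (c & Hc). destruct (singleton_ex HM c) as [a Ha].
      exists a. split; [now apply (finite_singleton HM a c)|].
      intros x Hx. apply Ha. exact (Hinj x c n Hx Hc).
Qed.
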